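(* Let $f\in\mathbb R[\mathbf x]=\mathbb R[x_1,\dots,x_n]$ with $\deg f=d$, and let $g_1,\dots,g_m\in\mathbb R[\mathbf x]$ with $\|g_j\|_{\sup}\le 1$ for $j=1,\dots,m$ be such that the set $S_{\mathbf g}=\{x\in\mathbb R^n:g_j(x)\ge 0,\ j=1,\dots,m\}$ is compact, nonempty and contained in $[-1,1]^n$. Choose a compact set $T\subseteq[-1,1]^n\times[0,1]^m$ such that $\{(x,\mathbf g(x)):x\in S_{\mathbf g}\}\subseteq T$. Then $f>0$ on $S_{\mathbf g}$ if and only if there is $F\in\mathbb R[\mathbf x,\mathbf u]=\mathbb R[x_1,\dots,x_n,u_1,\dots,u_m]$ with degree $\deg F=\max\{d,2d_{\mathbf g}\}$ such that (i) $f(\mathbf x)=F(\mathbf x,\mathbf g(\mathbf x))$, (ii) $\min_{(x,u)\in T}F(x,u)\ge\tfrac12 f_{\min}$, (iii) $\max_{(x,u)\in T}F(x,u)\le(1+2m\,\mathbf c_{\mathbf g}^2)\,\bigl(4d^2\kappa_{S_{\mathbf g}}(f)\bigr)^{2\mathbf L_{\mathbf g}}f_{\min}$.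
   Context: Notation: $\mathbf g=[g_1,\dots,g_m]$, $d_{\mathbf g}=\max\{\deg g_j:j=1,\dots,m\}$, $\|h\|_{\sup}=\sup_{x\in[-1,1]^n}|h(x)|$ for a polynomial $h\in\mathbb R[\mathbf x]$, $f_{\min}=\min_{x\in S_{\mathbf g}}f(x)$, and $\kappa_{S_{\mathbf g}}(f)=\|f\|_{\sup}/f_{\min}$ denotes the condition number of a polynomial $f>0$ on $S_{\mathbf g}$. Łojasiewicz exponent and constant: let $\operatorname{dist}(x,S_{\mathbf g})$ be the Euclidean distance from $x$ to $S_{\mathbf g}$ and let $G(x)=\max_{j=1,\dots,m}\max\{0,-g_j(x)\}$. Then $\mathbf L_{\mathbf g}$ and $\mathbf c_{\mathbf g}$ denote the Łojasiewicz exponent and constant corresponding to the pair $\operatorname{dist}(\cdot,S_{\mathbf g})$ and $G$ on $[-1,1]^n$, i.e. the exponent and constant given by the Łojasiewicz inequality $\operatorname{dist}(x,S_{\mathbf g})^{\mathbf L_{\mathbf g}}\le\mathbf c_{\mathbf g}\,G(x)$ for all $x\in[-1,1]^n$.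
   Formalization: Assumes d ≥ 1 (for a positive constant f, (iii) would read max F ≤ 0); if S_g = [-1,1]^n, where the inequality does not determine the exponent, requires L_g ≥ 1; and (iii) includes f_min ≠ 0, so that the condition number is defined. *)

(* Defs.v *)
From HB Require Import structures.
From mathcomp Require Import all_boot all_order all_algebra.
From mathcomp Require Import all_classical all_reals all_analysis.
(* The notations of mpoly clash with those of MathComp-Analysis. *)
From mathcomp Require Import -(notations) mpoly.

Set Implicit Arguments.
Unset Strict Implicit.
Unset Printing Implicit Defensive.

Import Order.TTheory GRing.Theory Num.Theory.
Import numFieldNormedType.Exports.
Local Open Scope classical_set_scope.
Local Open Scope ring_scope.

(* Total degree; [mpoly.msize p] is 1 + deg p for p != 0, and 0 for p = 0, so
   that the zero polynomial gets degree 0. *)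
Definition mpdeg (R : realType) (n : nat) (p : mpoly n R) : nat :=
  (mpoly.msize p).-1.

Definition mpeval (R : realType) (n : nat) (p : mpoly n R) (x : 'rV[R]_n) : R :=
  meval (x ord0) p.

(* Used only for a continuous [h] and a nonempty compact [A], where the infimum
   and the supremum are attained. *)
Definition min_on (R : realType) (X : Type) (A : set X) (h : X -> R) : R :=
  inf (h @` A).
Definition max_on (R : realType) (X : Type) (A : set X) (h : X -> R) : R :=
  sup (h @` A).

Definition box (R : realType) (n : nat) (a b : R) : set 'rV[R]_n :=
  [set x | forall i, a <= x ord0 i <= b].
Arguments box {R} n a b.

Definition supnorm (R : realType) (n : nat) (h : mpoly n R) : R :=
  max_on (box n (-1) 1) (fun x => `|mpeval h x|).

Definition semialg (R : realType) (n m : nat) (g : 'I_m -> mpoly n R) :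
    set 'rV[R]_n :=
  [set x | forall j, 0 <= mpeval (g j) x].

Definition geval (R : realType) (n m : nat) (g : 'I_m -> mpoly n R)
    (x : 'rV[R]_n) : 'rV[R]_m :=
  \row_j mpeval (g j) x.

Definition gdeg (R : realType) (n m : nat) (g : 'I_m -> mpoly n R) : nat :=
  \max_(j < m) mpdeg (g j).

Definition fmin (R : realType) (n m : nat) (g : 'I_m -> mpoly n R)
    (f : mpoly n R) : R :=
  min_on (semialg g) (mpeval f).

(* Meaningful only when [fmin g f != 0]; for [fmin g f = 0] the library
   convention makes this quotient 0. *)
Definition cond_number (R : realType) (n m : nat) (g : 'I_m -> mpoly n R)
    (f : mpoly n R) : R :=
  supnorm f / fmin g f.

(* [`|x|] on row vectors is the max norm, hence this explicit Euclidean norm. *)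
Definition enorm (R : realType) (n : nat) (x : 'rV[R]_n) : R :=
  Num.sqrt (\sum_(i < n) x ord0 i ^+ 2).

Definition edistance (R : realType) (n : nat) (x : 'rV[R]_n)
    (A : set 'rV[R]_n) : R :=
  inf [set enorm (x - y) | y in A].

Definition gviol (R : realType) (n m : nat) (g : 'I_m -> mpoly n R)
    (x : 'rV[R]_n) : R :=
  \big[Num.max/0]_(j < m) Num.max 0 (- mpeval (g j) x).

(* An exponent L and a constant c for the Lojasiewicz inequality between the
   distance to [semialg g] and [gviol g] on [-1, 1]^n.  If [semialg g] does not
   cover the box, the inequality forces L >= 1, because [gviol g] is Lipschitz.
   If it covers the box, both functions vanish and the inequality puts no
   constraint on L > 0; the same lower bound is then imposed. *)
Definition lojasiewicz (R : realType) (n m : nat) (g : 'I_m -> mpoly n R)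
    (L c : R) : Prop :=
  [/\ 0 < L,
      0 < c,
      forall x, box n (-1) 1 x ->
        edistance x (semialg g) `^ L <= c * gviol g x
    & box n (-1) 1 `<=` semialg g -> 1 <= L].

(* A polynomial in R[x, u] is an element of [mpoly (n + m) R], whose first n
   variables are x and whose last m variables are u. *)
Definition mpeval2 (R : realType) (n m : nat) (F : mpoly (n + m) R)
    (p : 'rV[R]_n * 'rV[R]_m) : R :=
  mpeval F (row_mx p.1 p.2).

Definition mpsubst (R : realType) (n m : nat) (g : 'I_m -> mpoly n R)
    (F : mpoly (n + m) R) : mpoly n R :=
  comp_mpoly [tuple match fintype.split k with
                    | inl i => mpolyX R (mnm1 i)
                    | inr j => g j
                    end | k < n + m] F.

(* Main.v *)
Require Import Defs.
From HB Require Import structures.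
From mathcomp Require Import all_boot all_order all_algebra.
From mathcomp Require Import all_classical all_reals all_analysis.
From mathcomp Require Import ring lra polyrcf.
From mathcomp Require Import -(notations) mpoly.

Set Implicit Arguments.
Unset Strict Implicit.
Unset Printing Implicit Defensive.

Import Order.TTheory GRing.Theory Num.Theory.
Import numFieldNormedType.Exports.
Local Open Scope classical_set_scope.
Local Open Scope ring_scope.

(** Write phi for the minimum of f on S, and B = 4 d^2 supnorm f / phi.  If
    f > 0 on S, then F is f plus a penalty for leaving the graph of g:
<<
      F(x, u) = f(x) + lam * |g(x) - u|^2,    lam = a * c^2 * B^(2L) * phi,
>>
    with a = 1/2 or a = 1/4.  The penalty vanishes on the graph, so
    F(x, g(x)) = f(x).  The three other requirements are obtained as follows.

    Lower bound.  As u >= 0, the length |g(x) - u| is at least the violation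
    G(x) of the constraints.  Let E be the distance from x to S and t = B * E.
    By Markov's inequality f is Lipschitz on the cube with constant
    2 d^2 supnorm f, so f(x) >= phi (1 - t/2); and the Lojasiewicz inequality
    gives lam * G(x)^2 >= a phi t^(2L).  It remains to see that
    1 - t/2 + a t^(2L) >= 1/2 for t >= 0.  This is clear for t <= 1; for
    t >= 1 it follows from t^(2L) >= t^2, a >= 1/4 and L >= 1
    ([penalty_lower_bound]).

    Upper bound.  Each coordinate of g(x) - u lies in [-2, 1], so the penalty
    is at most 4 m lam <= 2 m c^2 B^(2L) phi, and
    supnorm f <= phi B <= phi B^(2L) ([penalty_upper_bound]).

    Degree.  The leading forms of f and of the penalty may cancel, but the
    leading coefficient of a sum of squares of real polynomials is positive, so
    this happens for at most one value of lam; hence the two candidates for a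
    ([mpdeg_penalized]).

    Two facts of independent interest are needed.

    Markov's inequality on the cube ([markov_dirder]).  In one variable, at an
    end point, |p'(1)| <= N^2 max |p|: interpolate p at the extrema of the
    Chebyshev polynomial T_N, and note that the weights of the resulting formula
    for p'(1) have the alternating signs of the values of T_N, which makes T_N
    extremal ([markov_endpoint]).  In several variables, for x and v in the
    cube, the segments from x to -v and from x to v stay in the cube; the end
    point inequality on each of them bounds the derivatives at x along
    (x + v)/2 and (x - v)/2, whose difference is v.

    The exponent satisfies L >= 1 when S does not contain the cube
    ([lojasiewicz_exponent_ge1]): on the way from a nearest point of S to a
    point of the cube outside S, the distance to S grows linearly whereas
    G is Lipschitz, so that s^L = O(s) as s tends to 0.

    Conversely, f(x) = F(x, g(x)) on S yields phi >= phi / 2, hence phi > 0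
    since phi is not 0. *)

(** * Chebyshev nodes and Markov's inequality at an end point *)

Section Chebyshev.
Variable R : realType.
Implicit Types (p q : {poly R}) (k N : nat).

(** Chebyshev polynomials of the first kind. *)
Fixpoint cheb k : {poly R} :=
  match k with
  | 0 => 1
  | S k' => if k' is S k'' then 2%:R *: ('X * cheb k') - cheb k'' else 'X
  end.

Lemma chebSS k : cheb k.+2 = 2%:R *: ('X * cheb k.+1) - cheb k.
Proof. by []. Qed.

Lemma horner_cheb_cos k (t : R) : (cheb k).[cos t] = cos (k%:R * t).
Proof.
suff [] : (cheb k).[cos t] = cos (k%:R * t) /\
          (cheb k.+1).[cos t] = cos (k.+1%:R * t) by [].
elim: k => [|k [IH0 IH1]].
  by rewrite !hornerE ?(mulr0n, mulr1n, mul0r, mul1r) cos0.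
split=> //; rewrite chebSS hornerD hornerN hornerZ hornerM hornerX IH0 IH1.
have -> : k.+2%:R * t = k.+1%:R * t + t by rewrite -[k.+2]addn1 natrD; ring.
have -> : k%:R * t = k.+1%:R * t - t by rewrite -[k.+1]addn1 natrD; ring.
by rewrite cosB cosD; ring.
Qed.

Lemma size_cheb k : (size (cheb k) <= k.+1)%N.
Proof.
suff [] : (size (cheb k) <= k.+1)%N /\ (size (cheb k.+1) <= k.+2)%N by [].
elim: k => [|k [IH0 IH1]]; first by rewrite size_poly1 size_polyX.
split=> //; rewrite chebSS (leq_trans (size_polyD _ _)) // size_polyN geq_max.
rewrite [(size (cheb k) <= _)%N](leq_trans IH0) ?andbT; last first.
  exact: leqW (leqnSn _).
apply: leq_trans (size_scale_leq _ _) _.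
by apply: leq_trans (size_polyMleq _ _) _; rewrite size_polyX.
Qed.

Lemma deriv_cheb1 k : (cheb k)^`().[1] = k%:R ^+ 2.
Proof.
have ch1 i : (cheb i).[1] = 1 by rewrite -(cos0 R) horner_cheb_cos mulr0 cos0.
suff [] : (cheb k)^`().[1] = k%:R ^+ 2 /\
          (cheb k.+1)^`().[1] = k.+1%:R ^+ 2 by [].
elim: k => [|k [IH0 IH1]].
  by rewrite /= -[1]/(1%:P) derivC derivX !hornerE expr0n expr1n.
split=> //; rewrite chebSS derivD derivN derivZ derivM derivX mul1r.
rewrite !(hornerD, hornerN, hornerZ, hornerM, hornerX) IH0 IH1 ch1.
by rewrite -[k.+2]addn2 -[k.+1]addn1 !natrD; ring.
Qed.

(** The extrema of [cheb N] on [-1, 1] for [k <= N].  The Lagrange basis is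
    indexed by a globally injective sequence of nodes, so the nodes are
    continued past [N] by decreasing values below [-1]. *)
Definition cheb_node N k : R :=
  if (k <= N)%N then cos (k%:R / N%:R * pi) else - k%:R.

Lemma cheb_node_bound N k : (k <= N)%N -> -1 <= cheb_node N k <= 1.
Proof. by rewrite /cheb_node => ->; rewrite cos_geN1 cos_le1. Qed.

Lemma cheb_node_decr N i j : (0 < N)%N -> (i < j)%N ->
  cheb_node N j < cheb_node N i.
Proof.
move=> N0 ij; rewrite /cheb_node.
have N0R : 0 < N%:R :> R by rewrite ltr0n.
have angle k : (k <= N)%N -> k%:R / N%:R * pi \in `[0, (pi : R)].
  move=> kN; rewrite in_itv /= mulr_ge0 ?divr_ge0 ?ler0n ?pi_ge0 //=.
  by rewrite ler_piMl ?pi_ge0 // ler_pdivrMr // mul1r ler_nat.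
case: (leqP j N) => jN.
  rewrite (leq_trans (ltnW ij) jN) ltr_cos ?angle ?(leq_trans (ltnW ij)) //.
  by rewrite ltr_pM2r ?pi_gt0 // ltr_pM2r ?invr_gt0 // ltr_nat.
case: (leqP i N) => iN; last by rewrite ltrN2 ltr_nat.
apply: lt_le_trans (cos_geN1 _); rewrite ltrN2 ltr1n.
exact: leq_ltn_trans N0 jN.
Qed.

Lemma cheb_node_inj N : (0 < N)%N -> injective (cheb_node N).
Proof.
move=> N0 i j eij; case: (ltngtP i j) => // /(cheb_node_decr N0).
  by rewrite eij ltxx.
by rewrite eij ltxx.
Qed.

Lemma cheb_at_node N k : (0 < N)%N -> (k <= N)%N ->
  (cheb N).[cheb_node N k] = (-1) ^+ k.
Proof.
move=> N0 kN; rewrite /cheb_node kN horner_cheb_cos.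
have -> : N%:R * (k%:R / N%:R * pi) = k%:R * pi :> R.
  by field; rewrite pnatr_eq0 -lt0n.
elim: k {kN} => [|k IH]; first by rewrite mul0r cos0.
by rewrite -natr1 mulrDl mul1r cosDpi IH exprS mulN1r.
Qed.

Lemma prodXsubC_right_ge0 (I : Type) (r : seq I) (P : pred I) (x : I -> R) a :
    (forall i, P i -> x i <= a) ->
  let q := \prod_(i <- r | P i) ('X - (x i)%:P) in
  0 <= q.[a] /\ 0 <= q^`().[a].
Proof.
move=> xa; apply: (big_ind (fun q => 0 <= q.[a] /\ 0 <= q^`().[a])).
- by rewrite -[1]/(1%:P) derivC !hornerE ler01.
- move=> p q [p0 dp0] [q0 dq0]; rewrite derivM hornerD !hornerM.
  by rewrite addr_ge0 ?mulr_ge0.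
- by move=> i Pi; rewrite derivXsubC !hornerE subr_ge0 xa ?ler01.
Qed.

(** The numerator of the Lagrange polynomial is a product of factors [X - y]
    with [y <= 1], so that its derivative at 1 is nonnegative; its denominator
    has one negative factor for each of the [k] nodes to the right of node
    [k]. *)
Lemma lagrange_deriv_sign N (k : 'I_N.+1) : (0 < N)%N ->
  0 <= (-1) ^+ k * (tnth (lagrange N.+1 (cheb_node N)) k : {poly R})^`().[1].
Proof.
move=> N0; rewrite lagrangeE //; last exact: cheb_node_inj.
set x := cheb_node N.
rewrite /= mul_polyC derivZ hornerZ mulrA mulr_ge0 //; last first.
  apply: (prodXsubC_right_ge0 _ (x := fun j : 'I_N.+1 => x j) _).2 => j _.
  by case/andP: (cheb_node_bound (leq_ord j)).
rewrite -signr_odd -invr_sign -invfM invr_ge0 signr_odd.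
have -> : (-1) ^+ k = \prod_(j < N.+1 | j != k) (-1) ^+ (j < k)%N :> R.
  rewrite prodrXr; congr (_ ^+ _).
  (* The exponent [k] counts the nodes of index [j < k]. *)
  rewrite -[LHS]card_ord -sum1_card (big_ord_widen N.+1 (fun=> 1%N)) 1?ltnW //.
  rewrite big_mkcond [RHS]big_mkcond; apply: eq_bigr => i _.
  by rewrite -val_eqE /=; case: ltngtP.
rewrite horner_prod -big_split; apply: prodr_ge0 => j jk.
rewrite hornerXsubC; case: ltnP => kj; rewrite /= ?mulN1r ?mul1r.
  by rewrite opprB subr_ge0 ltW // cheb_node_decr.
by rewrite subr_ge0 ltW // cheb_node_decr // ltn_neqAle eq_sym jk.
Qed.

(** In the quadrature formula [p'(1) = sum_k p(x_k) w_k] the weights have the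
    signs of [T_N(x_k) = (-1)^k].  Hence [sum_k |w_k|] is the value of the
    formula at [T_N], that is [T_N'(1) = N^2]. *)
Lemma markov_endpoint N p (M : R) : (0 < N)%N -> (size p <= N.+1)%N ->
    (forall x : R, -1 <= x <= 1 -> `|p.[x]| <= M) ->
  `|p^`().[1]| <= N%:R ^+ 2 * M.
Proof.
move=> N0 sp pM.
pose x := cheb_node N.
pose w (k : 'I_N.+1) := (tnth (lagrange N.+1 x) k : {poly R})^`().[1].
have quad q : (size q <= N.+1)%N -> q^`().[1] = \sum_(k < N.+1) q.[x k] * w k.
  move=> sq; rewrite {1}(lagrange_gen _ (cheb_node_inj N0) sq) //.
  rewrite raddf_sum horner_sum; apply: eq_bigr => k _.
  by rewrite mul_polyC /= derivZ hornerZ.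
rewrite -deriv_cheb1 !quad ?size_cheb // mulr_suml.
apply: le_trans (ler_norm_sum _ _ _) _; apply: ler_sum => k _.
rewrite cheb_at_node ?leq_ord // normrM mulrC.
have -> : `|w k| = (-1) ^+ k * w k.
  rewrite -[RHS]ger0_norm; first by rewrite normrM normr_sign mul1r.
  exact: lagrange_deriv_sign.
apply: ler_wpM2l; first exact: lagrange_deriv_sign.
exact/pM/cheb_node_bound/leq_ord.
Qed.

End Chebyshev.
(** * Polynomials on lines, and the Lipschitz bound on the cube *)

Lemma mpoly_closed_ind (R : comNzRingType) n (P : mpoly n R -> Prop) :
    (forall c, P (mpolyC n c)) -> (forall i, P (mpolyX R (mnm1 i))) ->
    (forall p q, P p -> P q -> P (p + q)) ->
    (forall p q, P p -> P q -> P (p * q)) ->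
  forall p, P p.
Proof.
move=> PC PX PD PM p; elim/mpolyind: p => [|c m p _ _ Pp].
  by rewrite -(mpolyC0 n R).
apply: (PD) => //; rewrite -mul_mpolyC; apply: (PM) => //; rewrite mpolyXE_id.
have P1 : P 1 by rewrite -(mpolyC1 n R).
apply: (big_ind P P1 PM) => i _; elim: (m i) => [|k IH]; first by rewrite expr0.
by rewrite exprS; apply: PM.
Qed.

Section MaxNorm.
Variable R : realType.

Lemma rV_norm_le n (v : 'rV[R]_n) (r : R) : 0 <= r ->
  (forall i, `|v ord0 i| <= r) <-> `|v| <= r.
Proof.
move=> r0; rewrite [`|v|]mx_normrE; split=> [vr|vr i].
  by apply: bigmax_le => // -[i j] _; rewrite (ord1 i).
apply: le_trans vr; exact: (le_bigmax _ (fun ij => `|v ij.1 ij.2|) (ord0, i)).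
Qed.

Lemma boxE n (x : 'rV[R]_n) : box n (-1) 1 x <-> `|x| <= 1.
Proof.
by rewrite -rV_norm_le //; split=> xb i; move: (xb i); rewrite ler_norml.
Qed.

Lemma rV_norm_le_enorm n (v : 'rV[R]_n) : `|v| <= enorm v.
Proof.
apply/rV_norm_le => [|i]; first exact: sqrtr_ge0.
rewrite -sqrtr_sqr ler_wsqrtr // (bigD1 i) //= lerDl.
by apply: sumr_ge0 => j _; apply: sqr_ge0.
Qed.

Lemma unit_ball_convex n (x y : 'rV[R]_n) (t : R) :
  0 <= t <= 1 -> `|x| <= 1 -> `|y| <= 1 -> `|t *: x + (1 - t) *: y| <= 1.
Proof.
move=> /andP[t0 t1] x1 y1; apply: le_trans (ler_normD _ _) _.
rewrite (normrZ _ x) (normrZ _ y) !ger0_norm ?subr_ge0 //.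
rewrite -[leRHS](subrK t 1) addrC.
by apply: lerD; rewrite ler_piMr ?subr_ge0.
Qed.

End MaxNorm.

Section Line.
Variables (R : realType) (n : nat).
Implicit Types (f : mpoly n R) (x v w : 'rV[R]_n).

Lemma mpeval_continuous f : continuous (mpeval f : 'rV[R]_n -> R).
Proof.
elim/mpoly_closed_ind: f => [c|i|p q cp cq|p q cp cq] x.
- rewrite (_ : mpeval _ = cst c); first exact: cst_continuous.
  by apply/funext => y; rewrite /mpeval mevalC.
- rewrite (_ : mpeval _ = fun y : 'rV[R]_n => y ord0 i).
    exact: coord_continuous.
  by apply/funext => y; rewrite /mpeval mevalXU.
- rewrite (_ : mpeval _ = fun y => mpeval p y + mpeval q y).
    exact: (continuousD (cp x) (cq x)).
  by apply/funext => y; rewrite /mpeval mevalD.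
- rewrite (_ : mpeval _ = fun y => mpeval p y * mpeval q y).
    exact: (continuousM (cp x) (cq x)).
  by apply/funext => y; rewrite /mpeval mevalM.
Qed.

(** The univariate polynomial [t |-> f(x + t w)]. *)
Definition line_poly f x w : {poly R} :=
  mmap (@polyC R) (fun i => (x ord0 i)%:P + w ord0 i *: 'X) f.

(** The derivative of [f] at [x] along [w], linear in [w] by its form. *)
Definition dirder f w x : R :=
  \sum_i w ord0 i * mpeval (mderiv i f) x.

Lemma dirderB f v w x : dirder f (v - w) x = dirder f v x - dirder f w x.
Proof. by rewrite -sumrB; apply: eq_bigr => i _; rewrite !mxE mulrBl. Qed.

Lemma dirderZ f a w x : dirder f (a *: w) x = a * dirder f w x.
Proof. by rewrite mulr_sumr; apply: eq_bigr => i _; rewrite mxE mulrA. Qed.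

Lemma horner_line_poly f x w t :
  (line_poly f x w).[t] = mpeval f (x + t *: w).
Proof.
rewrite /line_poly /mpeval; elim/mpoly_closed_ind: f.
- by move=> c; rewrite mmapC mevalC hornerC.
- by move=> i; rewrite mmapX mmap1U mevalXU !hornerE !mxE mulrC.
- by move=> p q IHp IHq; rewrite mmapD mevalD hornerD IHp IHq.
- by move=> p q IHp IHq; rewrite rmorphM mevalM hornerM IHp IHq.
Qed.

Lemma deriv_line_poly f x w t :
  (line_poly f x w)^`().[t] = dirder f w (x + t *: w).
Proof.
elim/mpoly_closed_ind: f => [c|i|p q IHp IHq|p q IHp IHq].
- rewrite /line_poly mmapC derivC horner0 /dirder big1 // => i _.
  by rewrite mderivC /mpeval meval0 mulr0.
- rewrite /line_poly mmapX mmap1U derivD derivC derivZ derivX !hornerE /dirder.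
  rewrite (bigD1 i) //= big1 ?addr0 => [|j ji]; rewrite mderivX mnm1E /mpeval.
    by rewrite eqxx mevalZ -{1}[mnm1 i]add0m addmK mpolyX0 meval1 !mulr1.
  by rewrite eq_sym (negPf ji) scale0r meval0 mulr0.
- rewrite /line_poly mmapD derivD hornerD IHp IHq -big_split.
  by apply: eq_bigr => i _; rewrite mderivD /mpeval mevalD mulrDr.
- rewrite /line_poly rmorphM derivM hornerD !hornerM IHp IHq.
  rewrite !horner_line_poly mulr_suml mulr_sumr -big_split.
  apply: eq_bigr => i _; rewrite mderivM /mpeval mevalD !mevalM /=; ring.
Qed.

Lemma size_line_poly f x w : (size (line_poly f x w) <= (mpdeg f).+1)%N.
Proof.
rewrite /line_poly /mmap; apply: (leq_trans (size_sum _ _ _)).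
apply/bigmax_leqP_seq => m mf _; rewrite mul_polyC.
apply: leq_trans (size_scale_leq _ _) _.
set h := fun i => _ : {poly R}.
have h_le i : (size (h i) <= 2)%N.
  rewrite (leq_trans (size_polyD _ _)) // geq_max.
  rewrite (leq_trans (size_polyC_leq1 _)) //=.
  by rewrite (leq_trans (size_scale_leq _ _)) // size_polyX.
have : (size (mmap1 h m) <= (mdeg m).+1)%N.
  rewrite /mmap1 mdegE.
  elim/big_ind2: _ => [|k1 q1 k2 q2 H1 H2|i _]; first by rewrite size_poly1.
    apply: leq_trans (size_polyMleq _ _) _.
    by rewrite -subn1 leq_subLR add1n -addnS -addSn leq_add.
  apply: leq_trans (size_poly_exp_leq _ _) _; rewrite ltnS.
  by rewrite -[leqRHS]mul1n leq_mul2r -subn1 leq_subLR h_le orbT.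
move/leq_trans; apply; rewrite /mpdeg.
by have := msize_mdeg_lt mf; case: (mpoly.msize f).
Qed.

End Line.
Section Markov.
Variables (R : realType) (n : nat).
Implicit Types (f : mpoly n R) (x y v w : 'rV[R]_n).

Lemma mpeval_bounded f :
  exists B : R, forall x, `|x| <= 1 -> `|mpeval f x| <= B.
Proof.
rewrite /mpeval.
elim/mpoly_closed_ind: f => [c|i|p q [B pB] [C qC]|p q [B pB] [C qC]].
- by exists `|c| => x _; rewrite mevalC.
- by exists 1 => x /(rV_norm_le _ ler01) xi; rewrite mevalXU.
- exists (B + C) => x x1; rewrite mevalD.
  by apply: le_trans (ler_normD _ _) (lerD (pB x x1) (qC x x1)).
- exists (B * C) => x x1; rewrite mevalM normrM.
  by rewrite ler_pM ?pB ?qC.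
Qed.

Lemma mpeval_le_supnorm f x : `|x| <= 1 -> `|mpeval f x| <= supnorm f.
Proof.
move=> x1; apply: ub_le_sup; last by exists x => //; apply/boxE.
have [B fB] := mpeval_bounded f.
by exists B => _ [y /boxE y1 <-]; apply: fB.
Qed.

(** The segment from [y] to [x], parametrized by [-1, 1], stays in the cube and
    has velocity [(x - y) / 2]: this is [markov_endpoint] at its end [x]. *)
Lemma dirder_endpoint f N x y : (0 < N)%N -> (mpdeg f <= N)%N ->
    `|x| <= 1 -> `|y| <= 1 ->
  `|dirder f (2^-1 *: (x - y)) x| <= N%:R ^+ 2 * supnorm f.
Proof.
move=> N0 fN x1 y1; set w := 2^-1 *: (x - y).
have xw : x = (x - w) + 1 *: w by rewrite scale1r subrK.
rewrite {1}xw -deriv_line_poly; apply: markov_endpoint => // [|t /andP[t0 t1]].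
  exact: leq_trans (size_line_poly _ _ _) _.
rewrite horner_line_poly; apply: mpeval_le_supnorm.
have -> : x - w + t *: w = ((1 + t) / 2) *: x + (1 - (1 + t) / 2) *: y.
  by apply/rowP => i; rewrite !mxE; field.
by apply: unit_ball_convex => //; apply/andP; split; lra.
Qed.

(** Near a corner of the cube the chord through [x] in the direction [v] may be
    arbitrarily short.  The vector [v = (x + v)/2 - (x - v)/2] is therefore
    decomposed along two segments that have [x] as an end point and stay in the
    cube whenever [v] does; each contributes [N^2]. *)
Lemma markov_dirder f N x v : (0 < N)%N -> (mpdeg f <= N)%N -> `|x| <= 1 ->
  `|dirder f v x| <= 2 * N%:R ^+ 2 * supnorm f * `|v|.
Proof.
move=> N0 fN x1.
have unit u : `|u| <= 1 -> `|dirder f u x| <= 2 * N%:R ^+ 2 * supnorm f.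
  move=> u1.
  have -> : u = 2^-1 *: (x - - u) - 2^-1 *: (x - u).
    by apply/rowP => i; rewrite !mxE; field.
  rewrite dirderB; apply: le_trans (ler_normB _ _) _.
  rewrite -mulrA mulr2n mulrDl mul1r.
  by apply: lerD; apply: dirder_endpoint; rewrite ?normrN.
have [->|v0] := eqVneq v 0.
  by rewrite normr0 mulr0 -(scale0r (0 : 'rV[R]_n)) dirderZ mul0r normr0.
have nv0 : 0 < `|v| by rewrite normr_gt0.
rewrite -ler_pdivrMr // -[X in _ / X]ger0_norm // -normfV mulrC -normrM.
rewrite -dirderZ; apply: unit.
by rewrite normrZ normfV normr_id mulVf // gt_eqF.
Qed.

Lemma mpeval_lipschitz f N x y : (0 < N)%N -> (mpdeg f <= N)%N ->
    `|x| <= 1 -> `|y| <= 1 ->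
  `|mpeval f x - mpeval f y| <= 2 * N%:R ^+ 2 * supnorm f * `|x - y|.
Proof.
move=> N0 fN x1 y1; pose p := line_poly f y (x - y).
have [t /andP[/ltW t0 /ltW t1]] := poly_mvt p (@ltr01 R).
rewrite !horner_line_poly deriv_line_poly scale1r scale0r addr0 subrKC subr0.
rewrite mulr1 => ->; apply: markov_dirder => //.
have -> : y + t *: (x - y) = t *: x + (1 - t) *: y.
  by apply/rowP => i; rewrite !mxE; ring.
by apply: unit_ball_convex => //; rewrite t0 t1.
Qed.

End Markov.
(** * The exponent in the Lojasiewicz inequality *)

Section Lojasiewicz.
Variable R : realType.

Lemma powR_le_linear_ge1 (L C D : R) : 0 < C -> 0 < D ->
    (forall s, 0 < s <= D -> s `^ L <= C * s) -> 1 <= L.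
Proof.
move=> C0 D0 sLC; rewrite leNgt; apply/negP => L1.
pose e := 1 - L; have e0 : 0 < e by rewrite subr_gt0.
(* For this [s], [C * s ^ (1 - L)] is at most 1/2. *)
pose s := Num.min D ((2 * C)^-1 `^ e^-1).
have s0 : 0 < s by rewrite lt_min D0 powR_gt0 // invr_gt0 mulr_gt0.
have : s `^ L <= C * s by apply: sLC; rewrite s0 ge_min lexx.
have sE : s = s `^ L * s `^ e.
  rewrite -powRD; last by apply/implyP => _; rewrite gt_eqF.
  by rewrite addrC subrK powRr1 // ltW.
rewrite [X in _ * X]sE mulrCA -[leLHS]mulr1 ler_pM2l ?powR_gt0 // => le1.
have : s `^ e <= (2 * C)^-1.
  have -> : (2 * C)^-1 = ((2 * C)^-1 `^ e^-1) `^ e.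
    by rewrite -powRrM mulVf ?gt_eqF // powRr1 // invr_ge0 mulr_ge0 // ltW.
  apply: ge0_ler_powR; first exact: ltW.
  - by rewrite nnegrE ltW.
  - by rewrite nnegrE powR_ge0.
  - by rewrite ge_min lexx orbT.
rewrite -(ler_pM2l C0) => /(le_trans le1).
by rewrite invfM mulrCA mulfV ?gt_eqF // mulr1 => ?; lra.
Qed.

Variables (n m : nat) (g : 'I_m -> mpoly n R).
Implicit Types (x y : 'rV[R]_n) (A : set 'rV[R]_n).

Lemma gviol_ge0 x : 0 <= gviol g x.
Proof. exact: bigmax_ge_id. Qed.

Lemma gviol_le x (r : R) : 0 <= r -> (forall j, - mpeval (g j) x <= r) ->
  gviol g x <= r.
Proof. by move=> r0 gr; apply: bigmax_le => // j _; rewrite ge_max r0 gr. Qed.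

Lemma edistance_ge A x (r : R) : A !=set0 ->
  (forall y, A y -> r <= enorm (x - y)) -> r <= edistance x A.
Proof.
move=> [y Ay] rA; apply: lb_le_inf; first by exists (enorm (x - y)), y.
by move=> _ [z Az <-]; apply: rA.
Qed.

Lemma edistance_ge0 A x : A !=set0 -> 0 <= edistance x A.
Proof. by move=> A0; apply: edistance_ge => // y _; apply: sqrtr_ge0. Qed.

(** Let [x] be in the cube and outside of S, and [y] in S nearest to [x] for the
    max norm.  The point of the segment [y, x] at max norm distance [s] from
    [y] is at distance at least [s] from S, by the choice of [y] and because
    the max norm is at most the Euclidean one, whereas [gviol] is [O(s)] there
    by the Lipschitz bound.  So [s^L = O(s)]. *)
Lemma lojasiewicz_exponent_ge1 (L c : R) :
    (forall j, supnorm (g j) <= 1) -> compact (semialg g) ->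
    semialg g !=set0 -> semialg g `<=` box n (-1) 1 ->
  lojasiewicz g L c -> 1 <= L.
Proof.
move=> g1 Scpt S0 Sbox [L0 c0 loj cover].
have [/cover //|/existsNP[x /not_implyP[/boxE x1 Sx]]] :=
  pselect (box n (-1) 1 `<=` semialg g).
have [|y /set_mem Sy ymin] := EVT_min_rV (f := fun y => `|x - y|) S0 Scpt.
  apply: continuous_subspaceT => y.
  have xB : (fun z : 'rV[R]_n => x - z) @ y --> x - y.
    by apply: continuousB => //; exact: cst_continuous.
  exact: (cvg_norm xB).
have y1 : `|y| <= 1 by apply/boxE/Sbox.
pose D := `|x - y|.
have D0 : 0 < D.
  rewrite normr_gt0 subr_eq0; apply/eqP => exy.
  by apply: Sx; rewrite exy.
pose K : R := 2 * (gdeg g).+1%:R ^+ 2.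
have K0 : 0 < K by rewrite mulr_gt0 // exprn_gt0.
apply: (@powR_le_linear_ge1 _ (c * K) D) => [||s /andP[s0 sD]] //.
  exact: mulr_gt0.
pose t := s / D.
have t0 : 0 <= t by rewrite divr_ge0 // ltW.
have t1 : t <= 1 by rewrite ler_pdivrMr // mul1r.
pose xs := y + t *: (x - y).
have xs1 : `|xs| <= 1.
  have -> : xs = t *: x + (1 - t) *: y.
    by apply/rowP => i; rewrite !mxE; ring.
  by apply: unit_ball_convex => //; rewrite t0 t1.
have tD : t * D = s by rewrite divfK // gt_eqF.
have s_le : s <= edistance xs (semialg g).
  apply: edistance_ge => // z Sz; apply: le_trans (rV_norm_le_enorm _).
  have xxs : `|x - xs| = (1 - t) * D.
    have -> : x - xs = (1 - t) *: (x - y).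
      by apply/rowP => i; rewrite !mxE; ring.
    by rewrite normrZ ger0_norm // subr_ge0.
  have := ymin z (mem_set Sz); have := ler_distD xs x z.
  by rewrite xxs -/D mulrBl mul1r tD; lra.
apply: le_trans (ge0_ler_powR (ltW L0) _ _ s_le) _.
- by rewrite nnegrE ltW.
- by rewrite nnegrE edistance_ge0.
apply: (le_trans (loj _ _)); first exact/boxE.
rewrite -mulrA ler_pM2l //; apply: gviol_le => [|j].
  exact: mulr_ge0 (ltW K0) (ltW s0).
have gN : (mpdeg (g j) <= (gdeg g).+1)%N.
  by rewrite leqW // (leq_bigmax j).
have := mpeval_lipschitz (ltn0Sn _) gN xs1 y1.
have -> : `|xs - y| = s.
  by rewrite addrAC subrr add0r normrZ ger0_norm // -/D tD.
rewrite ler_norml => /andP[glow _].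
have gy : 0 <= mpeval (g j) y by apply: Sy.
have : 2 * (gdeg g).+1%:R ^+ 2 * supnorm (g j) * s <= K * s.
  by rewrite ler_pM2r // -[leRHS]mulr1 ler_pM2l.
by lra.
Qed.

End Lojasiewicz.
(** * Substitution and degree *)

Section Composition.
Variable R : realType.

Lemma comp_mpoly_var n k (t : n.-tuple (mpoly k R)) i :
  comp_mpoly t (mpolyX R (mnm1 i)) = tnth t i.
Proof. by rewrite [LHS]mmapX mmap1U. Qed.

Lemma comp_mpolyK n k (t : n.-tuple (mpoly k R)) (s : k.-tuple (mpoly n R)) :
    (forall i, comp_mpoly s (tnth t i) = mpolyX R (mnm1 i)) ->
  cancel (comp_mpoly t) (comp_mpoly s).
Proof.
move=> st p; elim/mpoly_closed_ind: p => [c|i|p q IHp IHq|p q IHp IHq].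
- by rewrite !comp_mpolyC.
- by rewrite comp_mpoly_var.
- by rewrite !comp_mpolyD IHp IHq.
- by rewrite !rmorphM /= IHp IHq.
Qed.

Lemma msizeM_leD n (p q : mpoly n R) a b :
    (mpoly.msize p <= a.+1)%N -> (mpoly.msize q <= b.+1)%N ->
  (mpoly.msize (p * q) <= (a + b).+1)%N.
Proof.
have [->|p0] := eqVneq p 0; first by rewrite mul0r msize0.
have [->|q0] := eqVneq q 0; first by rewrite mulr0 msize0.
by move=> pa qb; rewrite msizeM // -subn1 leq_subLR add1n -addnS -addSn leq_add.
Qed.

Lemma msize_le_mpdeg n (p : mpoly n R) : (mpoly.msize p <= (mpdeg p).+1)%N.
Proof. exact: leqSpred. Qed.

Lemma mpdeg_le n (p : mpoly n R) k :
  (mpoly.msize p <= k.+1)%N -> (mpdeg p <= k)%N.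
Proof. by rewrite /mpdeg; case: (mpoly.msize p). Qed.

Lemma msize_comp_mpoly n k (t : n.-tuple (mpoly k R)) (p : mpoly n R) :
    (forall i, (mpoly.msize (tnth t i) <= 2)%N) ->
  (mpoly.msize (comp_mpoly t p) <= (mpdeg p).+1)%N.
Proof.
move=> t1; rewrite comp_mpolyE; apply: leq_trans (mmeasure_sum _ _ _ _) _.
apply/bigmax_leqP_seq => mm mp _; apply: leq_trans (msizeZ_le _ _) _.
apply: (@leq_trans (mdeg mm).+1); last first.
  exact: leq_trans (msize_mdeg_lt mp) (msize_le_mpdeg p).
rewrite mdegE; apply: (big_ind2 (fun q a => mpoly.msize q <= a.+1)%N).
- by rewrite msize1.
- by move=> q a r b; apply: msizeM_leD.
- move=> i _; elim: (mm i) => [|e IH]; first by rewrite expr0 msize1.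
  by rewrite exprS; apply: (@msizeM_leD _ _ _ 1 e).
Qed.

Lemma mdeg_le_mpdeg n (p : mpoly n R) mm :
  mcoeff mm p != 0 -> (mdeg mm <= mpdeg p)%N.
Proof.
rewrite -mcoeff_msupp => /msize_mdeg_lt lt.
by rewrite -ltnS (leq_trans lt) // msize_le_mpdeg.
Qed.

Lemma mcoeff_gt_mpdeg n (p : mpoly n R) mm :
  (mpdeg p < mdeg mm)%N -> mcoeff mm p = 0.
Proof.
by move=> lt; apply/eqP; apply: contraTT lt => /mdeg_le_mpdeg; rewrite leqNgt.
Qed.

Lemma mpdeg_mlead n (p : mpoly n R) : mpdeg p = mdeg (mlead p).
Proof.
have [->|p0] := eqVneq p 0; first by rewrite /mpdeg msize0 mlead0 mdeg0.
by rewrite /mpdeg -mlead_deg.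
Qed.

(** Monomials are ordered by degree first, so the greatest leading monomial of
    the [g j] has degree [gdeg g]. *)
Lemma gdeg_common_mlead n m (g : 'I_m -> mpoly n R) : (0 < gdeg g)%N ->
  exists2 mu, mdeg mu = gdeg g &
    (forall j, (mlead (g j) <= mu)%O) /\ exists j, mcoeff mu (g j) != 0.
Proof.
move=> g0; have [j0] : exists j0 : 'I_m, true.
  case: (posnP m) g0 => [m0|m0 _]; last by exists (Ordinal m0).
  by rewrite /gdeg big1 // => j _; have := ltn_ord j; rewrite [leqRHS]m0.
move=> _; pose lead j := mlead (g j).
case: (@arg_maxP _ _ _ j0 xpredT lead isT) => j _ jmax.
have gj : gdeg g = mpdeg (g j).
  apply/eqP; rewrite eqn_leq [X in _ && X](leq_bigmax j) andbT.
  apply/bigmax_leqP => i _; rewrite !mpdeg_mlead; apply: lemc_mdeg.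
  exact: jmax.
exists (mlead (g j)); first by rewrite gj mpdeg_mlead.
split=> [i|]; first exact: jmax.
exists j; rewrite mleadc_eq0; apply: contraTneq g0 => gj0.
by rewrite gj gj0 /mpdeg msize0.
Qed.

End Composition.

(** * The penalized polynomial *)

Section Penalization.
Variables (R : realType) (n m : nat).
Implicit Types (f : mpoly n R) (g : 'I_m -> mpoly n R).

Definition lift_x f : mpoly (n + m) R :=
  comp_mpoly [tuple mpolyX R (mnm1 (lshift m i)) | i < n] f.

Definition var_u (j : 'I_m) : mpoly (n + m) R := mpolyX R (mnm1 (rshift n j)).

Definition penalized f g (lam : R) : mpoly (n + m) R :=
  lift_x f + lam *: \sum_j (lift_x (g j) - var_u j) ^+ 2.

(** The substitution of [a] for the x and of [b] for the u; [mpsubst g] is the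
    case of the variables themselves for [a], and [g] for [b]. *)
Definition xu_tuple (k : nat) (a : 'I_n -> mpoly k R) (b : 'I_m -> mpoly k R) :=
  [tuple match fintype.split k0 with inl i => a i | inr j => b j end
     | k0 < n + m].

Lemma comp_xu_lift_x (b : 'I_m -> mpoly n R) f :
  comp_mpoly (xu_tuple (fun i => mpolyX R (mnm1 i)) b) (lift_x f) = f.
Proof.
apply: comp_mpolyK => i; rewrite tnth_mktuple comp_mpoly_var tnth_mktuple.
by rewrite -[lshift m i]/(unsplit (inl i)) unsplitK.
Qed.

Lemma comp_xu_var_u (b : 'I_m -> mpoly n R) j :
  comp_mpoly (xu_tuple (fun i => mpolyX R (mnm1 i)) b) (var_u j) = b j.
Proof.
rewrite comp_mpoly_var tnth_mktuple.
by rewrite -[rshift n j]/(unsplit (inr j)) unsplitK.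
Qed.

Lemma comp_xu_penalized (b : 'I_m -> mpoly n R) f g lam :
  comp_mpoly (xu_tuple (fun i => mpolyX R (mnm1 i)) b) (penalized f g lam) =
  f + lam *: \sum_j (g j - b j) ^+ 2.
Proof.
rewrite comp_mpolyD comp_xu_lift_x comp_mpolyZ; congr (_ + _ *: _).
rewrite raddf_sum; apply: eq_bigr => j _.
by rewrite /= rmorphXn rmorphB /= comp_xu_lift_x comp_xu_var_u.
Qed.

Lemma mpsubst_penalized f g lam : mpsubst g (penalized f g lam) = f.
Proof.
rewrite [LHS]comp_xu_penalized big1 ?scaler0 ?addr0 // => j _.
by rewrite subrr expr0n.
Qed.

Lemma mpeval2_penalized f g lam x (u : 'rV[R]_m) :
  mpeval2 (penalized f g lam) (x, u) =
  mpeval f x + lam * enorm (geval g x - u) ^+ 2.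
Proof.
have lift_xE p : mpeval (lift_x p) (row_mx x u) = mpeval p x.
  rewrite /mpeval comp_mpoly_meval; apply: meval_eq => i.
  by rewrite tnth_mktuple mevalXU row_mxEl.
rewrite /enorm sqr_sqrtr; last by apply: sumr_ge0 => j _; apply: sqr_ge0.
rewrite /mpeval2 /penalized [LHS]mevalD mevalZ -/(mpeval _ _) lift_xE.
congr (_ + _ * _); rewrite raddf_sum; apply: eq_bigr => j _.
rewrite /= rmorphXn rmorphB /= -/(mpeval _ _) lift_xE mevalXU row_mxEr !mxE.
by [].
Qed.

Lemma mpdeg_penalized_le f g lam : (0 < gdeg g)%N ->
  (mpdeg (penalized f g lam) <= maxn (mpdeg f) (2 * gdeg g))%N.
Proof.
move=> g0; set D := maxn _ _.
apply: mpdeg_le.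
have lift_le p : (mpoly.msize (lift_x p) <= (mpdeg p).+1)%N.
  by apply: msize_comp_mpoly => i; rewrite tnth_mktuple msizeX mdeg1.
apply: leq_trans (mmeasureD_le _ _ _) _; rewrite geq_max; apply/andP; split.
  by apply: leq_trans (lift_le f) _; rewrite ltnS leq_maxl.
apply: leq_trans (msizeZ_le _ _) _; apply: leq_trans (mmeasure_sum _ _ _ _) _.
apply/bigmax_leqP => j _.
apply: (@leq_trans (2 * gdeg g).+1); last by rewrite ltnS leq_maxr.
have : (mpoly.msize (lift_x (g j) - var_u j) <= (gdeg g).+1)%N.
  apply: leq_trans (mmeasureD_le _ _ _) _; rewrite geq_max mmeasureN.
  rewrite msizeX mdeg1 ltnS g0 andbT (leq_trans (lift_le _)) // ltnS.
  exact: (leq_bigmax j).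
by rewrite expr2 mul2n -addnn => le; apply: msizeM_leD.
Qed.

(** A coefficient of [f + lam * Q], with [Q] the sum of the squares of the
    [g j], is also one of the image of the penalized polynomial under [u = 0],
    which does not raise degrees.  If [mpdeg f <= 2 * gdeg g], the coefficient at
    twice the greatest leading monomial of the [g j] is affine in [lam] with
    positive slope, hence nonzero for [l1] or for [l2].  Otherwise the leading
    monomial of [f] does not occur in [Q]. *)
Lemma mpdeg_penalized f g (l1 l2 : R) : (0 < mpdeg f)%N -> (0 < gdeg g)%N ->
    l1 != l2 ->
  mpdeg (penalized f g l1) = maxn (mpdeg f) (2 * gdeg g) \/
  mpdeg (penalized f g l2) = maxn (mpdeg f) (2 * gdeg g).
Proof.
move=> f0 g0 l12; set D := maxn _ _.
pose Q := \sum_j g j ^+ 2.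
have ge_of_coeff lam mu : mdeg mu = D -> mcoeff mu (f + lam *: Q) != 0 ->
    mpdeg (penalized f g lam) = D.
  move=> muD nz; apply/eqP; rewrite eqn_leq mpdeg_penalized_le //=.
  rewrite -muD; apply: leq_trans (mdeg_le_mpdeg nz) _.
  have <- : comp_mpoly (xu_tuple (fun i => mpolyX R (mnm1 i)) (fun=> 0%R))
      (penalized f g lam) = f + lam *: Q.
    rewrite comp_xu_penalized; congr (_ + _ *: _).
    by apply: eq_bigr => j _; rewrite subr0.
  apply: mpdeg_le; apply: msize_comp_mpoly => k; rewrite tnth_mktuple.
  by case: (fintype.split k) => [i|j]; rewrite ?msize0 // msizeX mdeg1.
have [mu0 mu0g [g_le [j0 gj0]]] := gdeg_common_mlead g0.
have Qmu : 0 < mcoeff (mnm_add mu0 mu0) Q.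
  rewrite /Q raddf_sum (bigD1 j0) //=.
  have sq j : mcoeff (mnm_add mu0 mu0) (g j ^+ 2) = mcoeff mu0 (g j) ^+ 2.
    by rewrite !expr2 mleadcMW.
  rewrite ltr_wpDr ?sq ?exprn_even_gt0 //.
  by apply: sumr_ge0 => j _; rewrite sq sqr_ge0.
have mu2 : mdeg (mnm_add mu0 mu0) = (2 * gdeg g)%N.
  by rewrite mdegD mu0g mul2n addnn.
case: (leqP (mpdeg f) (2 * gdeg g)) => fg.
  have muD : mdeg (mnm_add mu0 mu0) = D by rewrite mu2; apply/esym/maxn_idPr.
  have [c1|c1] := eqVneq (mcoeff (mnm_add mu0 mu0) (f + l1 *: Q)) 0; last first.
    by left; apply: ge_of_coeff muD c1.
  right; apply: ge_of_coeff muD _; apply: contraNneq l12 => c2.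
  move: c1; rewrite -c2 !mcoeffD !mcoeffZ => /addrI /mulIf -> //.
  by rewrite gt_eqF.
left; apply: (ge_of_coeff _ (mlead f)).
  by rewrite -mpdeg_mlead; apply/esym/maxn_idPl/ltnW.
rewrite mcoeffD mcoeffZ [X in _ * X](_ : _ = 0); last first.
  apply: mcoeff_gt_mpdeg; rewrite -mpdeg_mlead; apply: leq_ltn_trans fg.
  apply: mpdeg_le; apply: leq_trans (mmeasure_sum _ _ _ _) _.
  apply/bigmax_leqP => j _.
  rewrite expr2 mul2n -addnn; apply: msizeM_leD;
    by apply: leq_trans (msize_le_mpdeg _) _; rewrite ltnS (leq_bigmax j).
rewrite mulr0 addr0 mleadc_eq0; apply: contraTneq f0 => ->.
by rewrite /mpdeg msize0.
Qed.

End Penalization.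
(** * Estimates on the cube *)

Section Bounds.
Variables (R : realType) (n m : nat) (g : 'I_m -> mpoly n R).
Hypothesis (S_neq0 : semialg g !=set0).
Hypothesis (S_box : semialg g `<=` box n (-1) 1).
Implicit Types (f : mpoly n R) (x : 'rV[R]_n) (u : 'rV[R]_m).

(** Otherwise all the [g j] are constant and S is the whole space. *)
Lemma gdeg_gt0 : (0 < n)%N -> (0 < gdeg g)%N.
Proof.
move=> n0; rewrite lt0n; apply/eqP => g0.
have g_cst j x y : mpeval (g j) x = mpeval (g j) y.
  have gj1 : (mpoly.msize (g j) <= 1)%N.
    apply: leq_trans (msize_le_mpdeg _) _; rewrite ltnS -g0.
    exact: (leq_bigmax j).
  by rewrite (msize1_polyC gj1) /mpeval !mevalC.
have [x Sx] := S_neq0.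
have : box n (-1) 1 (const_mx 2 : 'rV[R]_n).
  by apply: S_box => j; rewrite (g_cst j _ x); apply: Sx.
by move=> /(_ (Ordinal n0)); rewrite mxE => /andP[_]; lra.
Qed.

Lemma fmin_le f x : semialg g x -> fmin g f <= mpeval f x.
Proof.
move=> Sx; apply: ge_inf; last by exists x.
have [B fB] := mpeval_bounded f.
exists (- B) => _ [y Sy <-]; have := fB y; rewrite ler_norml => fy.
by have /andP[] := fy (proj1 (boxE y) (S_box Sy)).
Qed.

Lemma fmin_gt0 f : compact (semialg g) ->
  (forall x, semialg g x -> 0 < mpeval f x) -> 0 < fmin g f.
Proof.
move=> S_cpt f_gt0.
have [|y /set_mem Sy ymin] := EVT_min_rV (f := mpeval f) S_neq0 S_cpt.
  exact/continuous_subspaceT/mpeval_continuous.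
apply: lt_le_trans (f_gt0 y Sy) _; apply: lb_le_inf.
  by exists (mpeval f y), y.
by move=> _ [z Sz <-]; apply/ymin/mem_set.
Qed.

Lemma fmin_sub_le f N x : (0 < N)%N -> (mpdeg f <= N)%N -> `|x| <= 1 ->
  0 < supnorm f ->
  fmin g f - mpeval f x <=
    2 * N%:R ^+ 2 * supnorm f * edistance x (semialg g).
Proof.
move=> N0 fN x1 f0.
have K0 : 0 < 2 * N%:R ^+ 2 * supnorm f.
  by apply: mulr_gt0 => //; apply: mulr_gt0; rewrite ?exprn_gt0 ?ltr0n.
rewrite mulrC -ler_pdivrMr //; apply: edistance_ge => // y Sy.
rewrite ler_pdivrMr // mulrC.
apply: le_trans (ler_wpM2l (ltW K0) (rV_norm_le_enorm _)).
have y1 : `|y| <= 1 by apply/boxE/S_box.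
have := mpeval_lipschitz N0 fN x1 y1; rewrite ler_norml => /andP[lip _].
by have := fmin_le f Sy; lra.
Qed.

(** As [0 <= u j], a violated constraint [g j x < 0] gives
    [- g j x <= |g j x - u j|]. *)
Lemma gviol_le_enorm x u : box m 0 1 u -> gviol g x <= enorm (geval g x - u).
Proof.
move=> u01; apply: gviol_le => [|j]; first exact: sqrtr_ge0.
have /andP[uj _] := u01 j.
have r0 : 0 <= enorm (geval g x - u) by apply: sqrtr_ge0.
have := proj2 (rV_norm_le _ r0) (rV_norm_le_enorm _) j.
by rewrite !mxE ler_norml => /andP[lo _]; lra.
Qed.

Lemma enorm_geval_sub_le x u : (forall j, supnorm (g j) <= 1) -> `|x| <= 1 ->
  box m 0 1 u -> enorm (geval g x - u) ^+ 2 <= 4 * m%:R.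
Proof.
move=> g1 x1 u01.
rewrite sqr_sqrtr; last by apply: sumr_ge0 => j _; apply: sqr_ge0.
apply: (@le_trans _ _ (\sum_(j < m) 4)); last first.
  by rewrite sumr_const card_ord mulr_natr.
apply: ler_sum => j _; rewrite !mxE.
have /andP[u0 u1] := u01 j.
have := le_trans (mpeval_le_supnorm (g j) x1) (g1 j).
by rewrite ler_norml => /andP[g_lo g_hi]; nra.
Qed.

End Bounds.

(** * The two inequalities between real numbers *)

(** With [t = B * E], the claim reduces to [1/2 <= 1 - t/2 + a t^(2L)].  For
    [t <= 1] the first two terms suffice.  For [t >= 1] one has
    [a t^(2L) >= t^2 / 4], and [1/2 - t/2 + t^2/4 = ((t - 1)^2 + 1) / 4]. *)
Lemma penalty_lower_bound (R : realType) (phi B E G c L a fx : R) :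
    0 < phi -> 0 <= B -> 0 <= E -> 0 < c -> 1 <= L -> 4^-1 <= a ->
    E `^ L <= c * G -> phi - fx <= phi * (B * E / 2) ->
  phi / 2 <= fx + a * c ^+ 2 * B `^ (2 * L) * phi * G ^+ 2.
Proof.
move=> phi0 B0 E0 c0 L1 a4 EL fxE; set t := B * E.
have t0 : 0 <= t by apply: mulr_ge0.
have pen : a * t `^ (2 * L) * phi <= a * c ^+ 2 * B `^ (2 * L) * phi * G ^+ 2.
  have -> : a * c ^+ 2 * B `^ (2 * L) * phi * G ^+ 2 =
            a * (B `^ (2 * L) * (c * G) ^+ 2) * phi by ring.
  rewrite ler_pM2r // ler_wpM2l //; first by lra.
  rewrite powRM // ler_wpM2l ?powR_ge0 // mulrC powRrM powR_mulrn ?powR_ge0 //.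
  by rewrite lerXn2r ?nnegrE ?powR_ge0 // (le_trans (powR_ge0 _ _) EL).
apply: le_trans (lerD (lexx fx) pen).
have {}fxE : phi * (1 - t / 2) <= fx by rewrite /t; lra.
have tL0 := powR_ge0 t (2 * L).
have [t1|t1] := leP t 1.
  have : 0 <= a * t `^ (2 * L) * phi by rewrite !mulr_ge0 //; lra.
  have : phi * t <= phi by rewrite ler_piMr // ltW.
  by lra.
have t2 : t ^+ 2 <= t `^ (2 * L).
  by rewrite -powR_mulrn //; apply: (ler_powR (ltW t1)); lra.
have : 4^-1 * t ^+ 2 * phi <= a * t `^ (2 * L) * phi.
  by rewrite ler_pM2r // ler_pM // ?sqr_ge0 //; lra.
have : 0 <= phi * ((t - 1) ^+ 2 + 1).
  by rewrite mulr_ge0 ?addr_ge0 ?sqr_ge0 // ltW.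
by nra.
Qed.

Lemma penalty_upper_bound (R : realType) (phi nf B c L a M q : R) :
    0 < phi -> 1 <= L -> a <= 2^-1 -> 0 <= M -> 0 <= q <= 4 * M ->
    1 <= B -> nf <= phi * B ->
  nf + a * c ^+ 2 * B `^ (2 * L) * phi * q <=
    (1 + 2 * M * c ^+ 2) * B `^ (2 * L) * phi.
Proof.
move=> phi0 L1 a2 M0 /andP[q0 qM] B1 nfB.
have BL : B <= B `^ (2 * L) by apply: le1r_powR => //; lra.
have : nf <= B `^ (2 * L) * phi.
  by apply: le_trans nfB _; rewrite mulrC ler_pM2r.
have : a * q * (c ^+ 2 * B `^ (2 * L) * phi) <=
       2^-1 * (4 * M) * (c ^+ 2 * B `^ (2 * L) * phi).
  apply: ler_wpM2r.
    by apply: (mulr_ge0 _ (ltW phi0)); rewrite mulr_ge0 ?sqr_ge0 ?powR_ge0.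
  by apply: le_trans (ler_wpM2r q0 a2) (ler_wpM2l _ qM); rewrite invr_ge0.
by lra.
Qed.

(** * The theorem *)

Theorem theorem2 (R : realType) (n m d : nat) (f : mpoly n R)
    (g : 'I_m -> mpoly n R) (L c : R) (T : set ('rV[R]_n * 'rV[R]_m))
    (f_deg : mpdeg f = d) (d_gt0 : (0 < d)%N)
    (g_le1 : forall j, supnorm (g j) <= 1)
    (S_compact : compact (semialg g))
    (S_neq0 : semialg g !=set0)
    (S_box : semialg g `<=` box n (-1) 1)
    (Lc : lojasiewicz g L c)
    (T_compact : compact T)
    (T_box : T `<=` box n (-1) 1 `*` box m 0 1)
    (T_graph : [set (x, geval g x) | x in semialg g] `<=` T) :
  (forall x, semialg g x -> 0 < mpeval f x) <->
  (exists F : mpoly (n + m) R,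
     [/\ mpdeg F = maxn d (2 * gdeg g),
         f = mpsubst g F,
         fmin g f / 2 <= min_on T (mpeval2 F)
       & fmin g f != 0 /\
         max_on T (mpeval2 F) <=
           (1 + 2 * m%:R * c ^+ 2)
           * (4 * d%:R ^+ 2 * cond_number g f) `^ (2 * L) * fmin g f]).
Proof.
have F_graph (F : mpoly (n + m) R) x : f = mpsubst g F ->
    mpeval2 F (x, geval g x) = mpeval f x.
  move=> ->; rewrite /mpeval /mpsubst comp_mpoly_meval; apply: meval_eq => k.
  rewrite tnth_mktuple mxE; case: (fintype.split k) => i.
    by rewrite mevalXU.
  by rewrite mxE.
have T_unit p : T p -> `|row_mx p.1 p.2| <= 1 /\ `|p.1| <= 1 /\ box m 0 1 p.2.
  case: p => x u /T_box[/= xb ub]; split; last by split => //; apply/boxE.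
  apply/boxE => k; rewrite mxE; case: (fintype.split k) => i; first exact: xb.
  by have /andP[] := ub i => ? ->; rewrite andbT; lra.
have [y Sy] := S_neq0.
have Ty : T (y, geval g y) by apply: T_graph; exists y.
split=> [f_gt0|[F [_ fF F_low [fmin_neq0 _]]] x Sx]; last first.
  have F_min z : semialg g z -> fmin g f / 2 <= mpeval f z.
    move=> Sz; apply: le_trans F_low _; rewrite -(F_graph F z fF).
    apply: ge_inf; last first.
      by exists (z, geval g z) => //; apply: T_graph; exists z.
    have [B FB] := mpeval_bounded F.
    exists (- B) => _ [p /T_unit[p1 _] <-].
    by have := FB _ p1; rewrite ler_norml => /andP[].
  have fmin_half : fmin g f / 2 <= fmin g f.
    apply: lb_le_inf; first by exists (mpeval f y), y.
    by move=> _ [z Sz <-]; apply: F_min.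
  have fmin_pos : 0 < fmin g f by rewrite lt_neqAle eq_sym fmin_neq0; lra.
  by apply: lt_le_trans (fmin_le S_box f Sx).
have phi0 := fmin_gt0 S_neq0 S_compact f_gt0; set phi := fmin g f in phi0 *.
have L1 := lojasiewicz_exponent_ge1 g_le1 S_compact S_neq0 S_box Lc.
have [_ c0 loj _] := Lc.
have y1 : `|y| <= 1 by apply/boxE/S_box.
have phi_f : phi <= supnorm f.
  apply: le_trans (fmin_le S_box f Sy) (le_trans (ler_norm _) _).
  exact: mpeval_le_supnorm.
have f0 : 0 < supnorm f := lt_le_trans phi0 phi_f.
set B := 4 * d%:R ^+ 2 * cond_number g f.
have phiB : phi * B = 4 * d%:R ^+ 2 * supnorm f.
  by rewrite /B /cond_number -/phi; field; rewrite gt_eqF.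
have d1 : 1 <= d%:R ^+ 2 :> R by rewrite exprn_ege1 // ler1n.
have B1 : 1 <= B.
  rewrite -(ler_pM2l phi0) phiB mulr1.
  apply: le_trans phi_f _; rewrite ler_peMl ?ltW //; lra.
pose lam a := a * c ^+ 2 * B `^ (2 * L) * phi.
have n0 : (0 < n)%N.
  move: d_gt0; rewrite -f_deg mpdeg_mlead mdegE lt0n sum_nat_eq0.
  by case/forallPn => i _; apply: leq_ltn_trans (ltn_ord i).
(* One of the two weights avoids a cancellation of leading forms. *)
have [a [a_lo a_hi a_deg]] : exists a, [/\ 4^-1 <= a, a <= 2^-1 &
    mpdeg (penalized f g (lam a)) = maxn d (2 * gdeg g)].
  have lam_neq : lam 2^-1 != lam 4^-1.
    have k0 : 0 < c ^+ 2 * B `^ (2 * L) * phi.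
      apply: (mulr_gt0 _ phi0); apply: mulr_gt0; first exact: exprn_gt0.
      exact/powR_gt0/(lt_le_trans ltr01 B1).
    rewrite /lam -!(mulrA _ (c ^+ 2)) -!(mulrA _ _ phi).
    by rewrite (inj_eq (mulIf _)) ?gt_eqF //; lra.
  rewrite -f_deg; case: (mpdeg_penalized _ _ lam_neq (f := f) (g := g)).
  - by rewrite f_deg.
  - exact: gdeg_gt0.
  - by move=> ?; exists 2^-1; split => //; lra.
  - by move=> ?; exists 4^-1; split => //; lra.
exists (penalized f g (lam a)); split => //.
- by rewrite mpsubst_penalized.
- apply: lb_le_inf.
    by eexists; exists (y, geval g y).
  move=> _ [[x u] /T_unit[_ [/= x1 u01]] <-].
  rewrite mpeval2_penalized.
  have viol := gviol_le_enorm g x u01.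
  have := penalty_lower_bound (fx := mpeval f x) (E := edistance x (semialg g))
    (G := gviol g x) phi0 (le_trans ler01 B1) _ c0 L1 a_lo (loj x _) _.
  move=> /(_ (edistance_ge0 _ S_neq0) (proj2 (boxE x) x1)).
  have fxE : phi - mpeval f x <= phi * (B * edistance x (semialg g) / 2).
    rewrite mulrA mulrA phiB.
    apply: le_trans (fmin_sub_le S_neq0 S_box d_gt0 _ x1 f0) _.
      by rewrite f_deg.
    lra.
  move=> /(_ fxE) /le_trans; apply.
  rewrite lerD2l -/(lam a) ler_wpM2l //.
    apply: (mulr_ge0 _ (ltW phi0)); apply: mulr_ge0 (powR_ge0 _ _).
    by rewrite mulr_ge0 ?sqr_ge0 //; lra.
  by rewrite lerXn2r ?nnegrE ?gviol_ge0 // sqrtr_ge0.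
- split; first by rewrite gt_eqF.
  apply: ge_sup.
    by eexists; exists (y, geval g y).
  move=> _ [[x u] /T_unit[_ [/= x1 u01]] <-].
  rewrite mpeval2_penalized.
  have q_bd : 0 <= enorm (geval g x - u) ^+ 2 <= 4 * m%:R.
    by rewrite sqr_ge0 enorm_geval_sub_le.
  have fB : supnorm f <= phi * B.
    by rewrite phiB ler_peMl ?(ltW f0) //; lra.
  apply: le_trans (penalty_upper_bound c phi0 L1 a_hi (ler0n _ m) q_bd B1 fB).
  by rewrite lerD2r (le_trans (ler_norm _)) // mpeval_le_supnorm.
Qed.
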